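(* Suppose $J:\mathcal{P}(\mathcal{X})\to\mathbb{R}$ is convex and $L$-smooth. Let $\mu_0\in\mathcal{P}(\mathcal{X})$ and let $\{\mu_k\}_{k\ge 0}$ be generated by the deterministic Frank-Wolfe recursion $$\mu_{k+1}=(1-\eta_k)\mu_k+\eta_k\,\delta_{x^*(\mu_k)},\qquad x^*(\mu_k)\in\arg\min_{x\in\mathcal{X}}h_{\mu_k}(x),\qquad k\ge 0,$$ with step sizes $\eta_k=\frac{2}{k+2}$, $k\ge 0$. Then $$J(\mu_k)-J^*\le\frac{2LR^2}{k+2},\qquad k\ge 1,$$ where $J^*:=\inf\{J(\mu):\mu\in\mathcal{P}(\mathcal{X})\}$ and $R:=\sup\{\|\mu-\nu\|:\mu,\nu\in\mathcal{P}(\mathcal{X})\}\le 2$.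
   Context: $\mathcal{X}$ is a nonempty compact subset of $\mathbb{R}^d$ with Borel $\sigma$-algebra $\mathcal{B}(\mathcal{X})$, $\mathcal{P}(\mathcal{X})$ is the set of Borel probability measures on $\mathcal{X}$, and $\delta_x$ is the Dirac measure at $x$. The functional $J$ is convex if $J((1-t)\mu+t\nu)\le(1-t)J(\mu)+tJ(\nu)$ for all $\mu,\nu\in\mathcal{P}(\mathcal{X})$, $t\in[0,1]$. The influence function of $J$ at $\mu$ is $h_\mu:\mathcal{X}\to\mathbb{R}$, $h_\mu(x)=\lim_{t\to0^+}\frac1t\{J(\mu+t(\delta_x-\mu))-J(\mu)\}$. The von Mises derivative of $J$ at $\mu$ is $J'_\mu(\nu)=\lim_{t\to0^+}\frac1t\{J(\mu+t(\nu-\mu))-J(\mu)\}$, $\nu\in\mathcal{P}(\mathcal{X})$; it is said to exist at $\mu$ if these limits exist and there is a measurable $\phi_\mu:\mathcal{X}\to\mathbb{R}$, integrable with respect to every $\nu\in\mathcal{P}(\mathcal{X})$, with $J'_\mu(\nu)=\int\phi_\mu\,\mathrm{d}(\nu-\mu)$ for all $\nu$. Then $h_\mu=\phi_\mu-\int\phi_\mu\,\mathrm{d}\mu$ and $J'_\mu(\nu)=\int h_\mu\,\mathrm{d}\nu$. Total variation distance: $\|\mu_1-\mu_2\|:=\sup_{A\in\mathcal{B}(\mathcal{X})}|\mu_1(A)-\mu_2(A)|$. $J$ is $L$-smooth if $\sup_{x\in\mathcal{X}}|h_{\mu_1}(x)-h_{\mu_2}(x)|\le L\|\mu_1-\mu_2\|$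 for all $\mu_1,\mu_2\in\mathcal{P}(\mathcal{X})$. Standing assumptions: the von Mises derivative of $J$ exists at every $\mu\in\mathcal{P}(\mathcal{X})$, and each $h_{\mu_k}$ attains its minimum on $\mathcal{X}$. *)

(* Defs.v *)
From HB Require Import structures.
From mathcomp Require Import all_boot all_order all_algebra.
From mathcomp Require Import all_classical all_reals all_analysis.

Set Implicit Arguments.
Unset Strict Implicit.
Unset Printing Implicit Defensive.
Import Order.TTheory GRing.Theory Num.Theory.
Import numFieldNormedType.Exports.

Local Open Scope classical_set_scope.
Local Open Scope ring_scope.

(* R^d is 'rV[R]_d; its library topology is the product topology, hence the
   Euclidean one.  The nonemptiness proof is a parameter of the carrier because
   measurable types are pointed; which point gets chosen is irrelevant. *)
Definition subset_space (R : realType) (d : nat) (X : set 'rV[R]_d)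
  (X0 : X !=set0) : Type := X.

Section subset_space_instances.
Context (R : realType) (d : nat) (X : set 'rV[R]_d) (X0 : X !=set0).

Definition subset_point : subset_space X0 :=
  exist _ (sval (cid X0)) (mem_set (svalP (cid X0))).

HB.instance Definition _ := Topological.copy (subset_space X0) (set_type X).
HB.instance Definition _ := isPointed.Build (subset_space X0) subset_point.

End subset_space_instances.

(* X with its Borel sigma-algebra, generated by the relatively open sets. *)
Definition borel_space (R : realType) (d : nat) (X : set 'rV[R]_d)
    (X0 : X !=set0) :=
  g_sigma_algebraType (@open (subset_space X0)).

Section mixture.
Context d (T : measurableType d) (R : realType).
Implicit Types (mu nu : probability T R) (t : R).

Definition clip01 t : R := Num.min 1 (Num.max 0 t).

Lemma clip01_ge0 t : 0 <= clip01 t.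
Proof. by rewrite le_min ler01 le_max lexx. Qed.

Lemma onem_clip01_ge0 t : 0 <= 1 - clip01 t.
Proof. by rewrite subr_ge0 ge_min lexx. Qed.

Lemma clip01_id t : 0 <= t <= 1 -> clip01 t = t.
Proof. by case/andP => t0 t1; rewrite /clip01 max_r// min_r. Qed.

(* The probability measure (1 - t) mu + t nu.  It is made total in t by
   clipping t to [0, 1]; see mixE. *)
Definition mix t mu nu : set T -> \bar R :=
  measure_add (mscale (NngNum (onem_clip01_ge0 t)) mu)
              (mscale (NngNum (clip01_ge0 t)) nu).

HB.instance Definition _ t mu nu := Measure.on (mix t mu nu).

Let mix_setT t mu nu : mix t mu nu setT = 1%E.
Proof.
rewrite /mix measure_addE /= /mscale /= !probability_setT.
by rewrite !mule1 -EFinD subrK.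
Qed.

HB.instance Definition _ t mu nu :=
  Measure_isProbability.Build _ _ _ (mix t mu nu) (mix_setT t mu nu).

Lemma mixE t mu nu (A : set T) : 0 <= t <= 1 ->
  mix t mu nu A = ((1 - t)%:E * mu A + t%:E * nu A)%E.
Proof. by move=> t01; rewrite /mix measure_addE /= /mscale /= clip01_id. Qed.

End mixture.

Section functionals.
Context d (T : measurableType d) (R : realType).
Implicit Types (J : probability T R -> R) (mu nu : probability T R).

Definition convex_functional J := forall mu nu (t : R), 0 <= t <= 1 ->
  J (mix t mu nu) <= (1 - t) * J mu + t * J nu.

Definition diff_quotient J mu nu (t : R) : R :=
  t^-1 * (J (mix t mu nu) - J mu).

Definition von_mises J mu nu : R := lim (diff_quotient J mu nu t @[t --> 0^'+]).

Definition von_mises_exists J mu :=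
  (forall nu, cvg (diff_quotient J mu nu t @[t --> 0^'+])) /\
  exists phi : T -> R,
    [/\ measurable_fun setT phi,
        forall nu, nu.-integrable setT (EFin \o phi) &
        forall nu, von_mises J mu nu =
          (\int[nu]_(x in setT) phi x) - (\int[mu]_(x in setT) phi x)].

Definition influence J mu (x : T) : R :=
  lim (diff_quotient J mu (\d_x : probability T R) t @[t --> 0^'+]).

(* The set is nonempty and bounded by 1, so the real supremum is genuine. *)
Definition tv_dist mu nu : R :=
  sup [set `|fine (mu A) - fine (nu A)| | A in measurable].

Definition smooth_functional (L : R) J := forall mu1 mu2,
  (ereal_sup [set `|influence J mu1 x - influence J mu2 x|%:E | x in setT]
   <= (L * tv_dist mu1 mu2)%:E)%E.

Definition argmin (f : T -> R) : set T := [set x | forall y, f x <= f y].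

Definition frank_wolfe J (eta : nat -> R) (x : nat -> T)
    (mu : nat -> probability T R) :=
  forall k, argmin (influence J (mu k)) (x k) /\
    mu k.+1 = mix (eta k) (mu k) (\d_(x k) : probability T R).

Definition inf_value J : \bar R := ereal_inf [set (J mu)%:E | mu in setT].

End functionals.

(* Bounded by 1 as well, since tv_dist is. *)
Definition tv_diameter d (T : measurableType d) (R : realType) : R :=
  sup [set r | exists mu nu : probability T R, r = tv_dist mu nu].

(* Main.v *)
(* With tv_dist the supremum of |mu A - nu A|, the usual estimate
   |\int g d(nu - mu)| <= 2 sup|g| tv_dist mu nu would give the rate
   4 L R^2 / (k + 2).  The factor 2 is recovered from the normalization
   \int h_m dm = 0.  Put m_t = (1 - t) mu + t \d_x, with x minimizing h_mu, and
   let b(t) = h_{m_t}(x) - \int h_{m_t} dmu be the slope of J along this segment.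
   The normalization at m_t reads
     (1 - t) b(t) = h_{m_t}(x)   and   t b(t) = - \int h_{m_t} dmu,
   so with G = - h_mu(x) >= J mu - inf J, smoothness gives
     (1 - t) b(t) <= L t - G   and   t b(t) <= s b(s) + L (t - s)  for s <= t.
   Convexity turns b into a subgradient, J m_t - J m_s <= (t - s) b(t).
   Integrating the first bound up to eta = 2 / (k + 2) closes the induction for
   k >= 2; the steps eta = 1 and eta = 2/3 also need the second bound, and there
   Riemann sums of mesh 1/6 suffice.  Finally the diameter R is 0 or 1, so that
   R^2 = R; when R = 0 every h_m vanishes at x and J mu is minimal. *)

Require Import Defs.
From mathcomp Require Import all_boot all_order all_algebra.
From mathcomp Require Import all_classical all_reals all_analysis.
From mathcomp Require Import measurable_realfun.
From mathcomp Require Import ring lra.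
Set Implicit Arguments.
Unset Strict Implicit.
Unset Printing Implicit Defensive.
Import Order.TTheory GRing.Theory Num.Theory.
Import numFieldNormedType.Exports.
Local Open Scope classical_set_scope.
Local Open Scope ring_scope.

(** Cut [[a, b]] into [n] equal pieces: the increments telescope and the defects total
    [C * (b - a) ^+ 2 / n], which vanishes as [n] grows. This integrates a slope bound for a
    function known only through its increments. *)
Lemma le_of_quadratic_defect (R : realType) (f : R -> R) (C a b : R) :
  a <= b ->
  (forall s t, a <= s -> s <= t -> t <= b -> f t - f s <= C * (t - s) ^+ 2) ->
  f b <= f a.
Proof.
move=> ab fC.
have step n : (0 < n)%N -> f b - f a <= (C * (b - a) ^+ 2) / n%:R.
  move=> n0; have nR0 : (0 : R) < n%:R by rewrite ltr0n.
  pose p i : R := a + (b - a) * (i%:R / n%:R).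
  have -> : f b - f a = \sum_(0 <= i < n) (f (p i.+1) - f (p i)).
    by rewrite telescope_sumr// /p mul0r mulr0 addr0 divff ?gt_eqF// mulr1 subrKC.
  have -> : C * (b - a) ^+ 2 / n%:R =
      \sum_(0 <= i < n) (C * ((b - a) / n%:R) ^+ 2).
    rewrite sumr_const_nat subn0 -mulr_natr; field.
    by rewrite gt_eqF.
  rewrite !big_nat; apply: ler_sum => i /= ilt.
  have := fC (p i) (p i.+1); have -> : p i.+1 - p i = (b - a) / n%:R.
    by rewrite /p -natr1; field; rewrite gt_eqF.
  have ba0 : 0 <= b - a by rewrite subr_ge0.
  apply.
  - by rewrite lerDl mulr_ge0// divr_ge0.
  - by rewrite lerD2l ler_wpM2l// ler_wpM2r ?invr_ge0 ?ler_nat// ltW.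
  - rewrite -lerBrDl ler_piMr// ler_pdivrMr// mul1r ler_nat.
    by move: ilt.
rewrite -subr_le0 leNgt; apply/negP => f0.
set c := C * (b - a) ^+ 2 in step.
have := archi_boundP (divr_ge0 (normr_ge0 c) (ltW f0)).
set n := Num.bound _ => nlt.
have n0 : (0 : R) < n%:R by apply: le_lt_trans nlt; rewrite divr_ge0// ltW.
have := step n; rewrite -(ltr0n R) => /(_ n0).
rewrite ler_pdivlMr// leNgt => /negP; apply.
by rewrite (le_lt_trans (ler_norm c))// mulrC -ltr_pdivrMr.
Qed.

Lemma fineDM (R : realType) (a b : R) (p q : \bar R) :
  p \is a fin_num -> q \is a fin_num ->
  fine (a%:E * p + b%:E * q)%E = a * fine p + b * fine q.
Proof. by case: p q => [p| |] [q| |]. Qed.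

(** * Integration against mixtures *)

Section integral_mix.
Context d (T : measurableType d) (R : realType).
Implicit Types (mu nu : probability T R) (f : T -> R).

(** For nonnegative integrands the integral is additive and homogeneous in the measure; this is
    applied to the positive and negative parts of [f], whose integrals are finite. *)
Lemma Rintegral_mix mu nu f (t : R) : 0 <= t <= 1 ->
  (forall P : probability T R, P.-integrable setT (EFin \o f)) ->
  \int[mix t mu nu]_x f x = (1 - t) * \int[mu]_x f x + t * \int[nu]_x f x.
Proof.
move=> t01 fi.
have mf := measurable_int _ (fi mu).
have pfin (P : probability T R) := integrable_pos_fin_num measurableT (fi P).
have nfin (P : probability T R) := integrable_neg_fin_num measurableT (fi P).
have finE (P : probability T R) :
  \int[P]_x f x = fine (\int[P]_x ((EFin \o f)^\+ x)) -
                  fine (\int[P]_x ((EFin \o f)^\- x)).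
  by rewrite /Rintegral integralE fineB.
have clipE := clip01_id t01.
have mixposE : (\int[mix t mu nu]_x ((EFin \o f)^\+ x) =
    (1 - t)%:E * \int[mu]_x ((EFin \o f)^\+ x) +
    t%:E * \int[nu]_x ((EFin \o f)^\+ x))%E.
  rewrite ge0_integral_measure_add//; last exact: measurable_funepos.
  by rewrite !ge0_integral_mscale/= ?clipE//; exact: measurable_funepos.
have mixnegE : (\int[mix t mu nu]_x ((EFin \o f)^\- x) =
    (1 - t)%:E * \int[mu]_x ((EFin \o f)^\- x) +
    t%:E * \int[nu]_x ((EFin \o f)^\- x))%E.
  rewrite ge0_integral_measure_add//; last exact: measurable_funeneg.
  by rewrite !ge0_integral_mscale/= ?clipE//; exact: measurable_funeneg.
rewrite !finE mixposE mixnegE.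
rewrite !fineDM ?pfin ?nfin//; ring.
Qed.

End integral_mix.

(** * Total variation distance and its diameter *)

Section tv_dist.
Context d (T : measurableType d) (R : realType).
Implicit Types (mu nu : probability T R) (A : set T).

Lemma fine_probability_itv mu A : measurable A -> 0 <= fine (mu A) <= 1.
Proof.
move=> mA; rewrite fine_ge0//= -lee_fin fineK ?probability_le1//.
exact: fin_num_measure.
Qed.

Lemma tv_dist_le mu nu (e : R) :
  (forall A, measurable A -> `|fine (mu A) - fine (nu A)| <= e) ->
  tv_dist mu nu <= e.
Proof.
move=> le_e; apply: ge_sup; first by exists `|fine (mu set0) - fine (nu set0)|, set0.
by move=> _ [A mA <-]; exact: le_e.
Qed.

Lemma fine_probabilityB_le1 mu nu A : measurable A ->
  `|fine (mu A) - fine (nu A)| <= 1.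
Proof.
move=> mA; have := fine_probability_itv mu mA.
have := fine_probability_itv nu mA.
by rewrite ler_norml; lra.
Qed.

Lemma tv_dist_le1 mu nu : tv_dist mu nu <= 1.
Proof. by apply: tv_dist_le => A; exact: fine_probabilityB_le1. Qed.

Lemma tv_dist_ge mu nu A : measurable A ->
  `|fine (mu A) - fine (nu A)| <= tv_dist mu nu.
Proof.
move=> mA; apply: ub_le_sup; last by exists A.
by exists 1 => _ [B mB <-]; exact: fine_probabilityB_le1.
Qed.

Lemma tv_dist_ge0 mu nu : 0 <= tv_dist mu nu.
Proof. exact: le_trans (tv_dist_ge mu nu measurable0). Qed.

Lemma fine_mixE mu nu (t : R) A : 0 <= t <= 1 -> measurable A ->
  fine (mix t mu nu A) = (1 - t) * fine (mu A) + t * fine (nu A).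
Proof.
move=> t01 mA; rewrite mixE//.
have muA := fin_num_measure mu _ mA; have nuA := fin_num_measure nu _ mA.
by rewrite fineDM.
Qed.

Lemma tv_dist_mix mu nu (s t : R) : 0 <= s <= 1 -> 0 <= t <= 1 ->
  tv_dist (mix s mu nu) (mix t mu nu) <= `|s - t|.
Proof.
move=> s01 t01; apply: tv_dist_le => A mA; rewrite !fine_mixE//.
rewrite [X in `|X|](_ : _ = (s - t) * (fine (nu A) - fine (mu A))); last by ring.
by rewrite normrM ler_piMr// fine_probabilityB_le1.
Qed.

Lemma tv_dist_mixl mu nu (t : R) : 0 <= t <= 1 -> tv_dist (mix t mu nu) mu <= t.
Proof.
move=> t01; apply: tv_dist_le => A mA; rewrite fine_mixE//.
rewrite [X in `|X|](_ : _ = t * (fine (nu A) - fine (mu A))); last by ring.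
case/andP: t01 => t0 _.
by rewrite normrM (ger0_norm t0) ler_piMr// fine_probabilityB_le1.
Qed.

Lemma tv_diameter_ubound :
  ubound [set r : R | exists mu nu : probability T R, r = tv_dist mu nu] 1.
Proof. by move=> _ [mu [nu ->]]; exact: tv_dist_le1. Qed.

Lemma tv_dist_le_diameter mu nu : tv_dist mu nu <= tv_diameter T R.
Proof.
apply: ub_le_sup; last by exists mu, nu.
by exists 1; exact: tv_diameter_ubound.
Qed.

Lemma tv_diameter_le1 : tv_diameter T R <= 1.
Proof.
apply: ge_sup; last exact: tv_diameter_ubound.
by exists (tv_dist (\d_point : probability T R) \d_point), \d_point, \d_point.
Qed.

(** The measures disagree on some measurable [A], so neither [A] nor its complement is empty; Dirac
    measures at a point of each are at distance 1. *)
Lemma tv_dist_neq0 mu nu : tv_dist mu nu != 0 ->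
  exists x y : T, tv_dist (\d_x : probability T R) \d_y = 1.
Proof.
move=> mn0.
have [A [mA AnA]] : exists A, measurable A /\ fine (mu A) != fine (nu A).
  apply/not_existsP => h; move/eqP: mn0; apply; apply/eqP.
  rewrite eq_le tv_dist_ge0 andbT; apply: tv_dist_le => A mA.
  have := h A => /not_andP[//|/negP]; rewrite negbK => /eqP ->.
  by rewrite subrr normr0.
have [x Ax] : A !=set0.
  apply/set0P/negP => /eqP A0; move: AnA.
  by rewrite A0 !measure0 eqxx.
have [y Ay] : (~` A) !=set0.
  apply/set0P/negP => /eqP A0; move: AnA.
  by rewrite -(setCK A) A0 setC0 !probability_setT eqxx.
exists x, y; apply/eqP; rewrite eq_le tv_dist_le1/=.
apply: le_trans (tv_dist_ge _ _ mA).
by rewrite /= /dirac !indicE mem_set// memNset//= subr0 normr1.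
Qed.

(** The pair of Dirac measures is recorded because [frank_wolfe_rate] derives [0 <= L] from it. *)
Lemma tv_diameter_eq01 : tv_diameter T R = 0 \/
  exists x y : T, tv_dist (\d_x : probability T R) \d_y = 1 /\ tv_diameter T R = 1.
Proof.
have [|h] := pselect (exists mu nu, tv_dist mu nu != 0).
  move=> [mu [nu /tv_dist_neq0[x [y xy]]]]; right; exists x, y; split=> //.
  apply/eqP; rewrite eq_le tv_diameter_le1/= -xy.
  exact: tv_dist_le_diameter.
left; apply/eqP; rewrite eq_le; apply/andP; split.
  apply: ge_sup.
    by exists (tv_dist (\d_point : probability T R) \d_point), \d_point, \d_point.
  move=> _ [mu [nu ->]]; rewrite leNgt; apply/negP => mn; apply: h.
  by exists mu, nu; rewrite gt_eqF.
exact: le_trans (tv_dist_ge0 _ _) (tv_dist_le_diameter \d_point \d_point).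
Qed.

End tv_dist.

(** * Influence functions and von Mises derivatives *)

Section influence.
Context d (T : measurableType d) (R : realType).
Context (J : probability T R -> R).
Implicit Types (m mu nu : probability T R).

Section derivative.
Context m (dJ : von_mises_exists J m).

(** [influence J m x] is by definition [von_mises J m \d_x], and integrating [phi] against [\d_x]
    evaluates it at [x]. *)
Lemma influence_phi : exists phi : T -> R,
  [/\ forall nu, nu.-integrable setT (EFin \o phi),
      forall nu, von_mises J m nu = \int[nu]_x phi x - \int[m]_x phi x &
      forall x, influence J m x = phi x - \int[m]_x phi x].
Proof.
case: dJ => _ [phi [mphi iphi vmE]]; exists phi; split=> // x.
rewrite [LHS](vmE \d_x); congr (_ - _).
rewrite /Rintegral integral_dirac//; first by rewrite diracT mul1e.
exact/measurable_EFinP.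
Qed.

Lemma influence_integrable nu : nu.-integrable setT (EFin \o influence J m).
Proof.
have [phi [iphi _ hE]] := influence_phi.
rewrite (_ : influence J m = fun x => phi x - (cst (\int[m]_y phi y) : T -> R) x).
  exact: (integrableB measurableT (iphi nu)
    (finite_measure_integrable_cst nu (\int[m]_y phi y) measurableT)).
by apply/funext => x; exact: hE.
Qed.

Lemma von_misesE nu : von_mises J m nu = \int[nu]_x influence J m x.
Proof.
have [phi [iphi vmE hE]] := influence_phi.
rewrite (_ : influence J m = fun x => phi x - (cst (\int[m]_y phi y) : T -> R) x).
  rewrite RintegralB//; [|exact: iphi|exact: finite_measure_integrable_cst].
  by rewrite Rintegral_cst//= probability_setT mulr1.
by apply/funext => x; exact: hE.
Qed.

Lemma Rintegral_influence : \int[m]_x influence J m x = 0.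
Proof. by rewrite -von_misesE; have [phi [_ -> _]] := influence_phi; rewrite subrr. Qed.

Lemma le_Rintegral_influence (c : R) nu : (forall y, c <= influence J m y) ->
  c <= \int[nu]_x influence J m x.
Proof.
move=> le_c; have -> : c = \int[nu]_x (cst c : T -> R) x.
  by rewrite Rintegral_cst//= probability_setT mulr1.
apply: le_Rintegral => //; first exact: finite_measure_integrable_cst.
exact: influence_integrable.
Qed.

(** By convexity every difference quotient with [0 < t <= 1] is at most [J nu - J m], and the bound
    passes to the limit. *)
Lemma convex_subgradient nu : convex_functional J ->
  \int[nu]_x influence J m x <= J nu - J m.
Proof.
move=> cJ; rewrite -von_misesE; apply: limr_le; first by case: dJ.
near=> t.
have t0 : 0 < t by near: t; exact: nbhs_right_gt.
have t1 : t <= 1 by near: t; exact: nbhs_right_le.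
rewrite /diff_quotient ler_pdivrMl//.
have := cJ m nu t; rewrite t1 ltW// => /(_ isT); lra.
Unshelve. all: by end_near. Qed.

End derivative.

Section smooth.
Context (L : R).
Context (dJ : forall m, von_mises_exists J m).
Context (sJ : smooth_functional L J).

Lemma influence_lipschitz mu nu y :
  `|influence J mu y - influence J nu y| <= L * tv_dist mu nu.
Proof.
rewrite -lee_fin; apply: le_trans (sJ mu nu).
by apply: ereal_sup_ubound; exists y.
Qed.

(** The derivative at [\d_y] towards itself is zero. Comparison with [\d_y] then bounds the
    influence function itself, in [norm_influence]. *)
Lemma influence_dirac y : influence J \d_y y = 0.
Proof.
by case: (dJ \d_y) => _ [phi [_ _ vmE]]; rewrite [LHS](vmE \d_y) subrr.
Qed.

Lemma norm_influence mu y : `|influence J mu y| <= L * tv_dist mu \d_y.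
Proof. by have := influence_lipschitz mu \d_y y; rewrite influence_dirac subr0. Qed.

Lemma Rintegral_influence_lipschitz mu nu m :
  `|\int[m]_x influence J mu x - \int[m]_x influence J nu x| <= L * tv_dist mu nu.
Proof.
have imu := influence_integrable (dJ mu) m.
have inu := influence_integrable (dJ nu) m.
have iB : m.-integrable setT
    (EFin \o (fun x => influence J mu x - influence J nu x)).
  exact: (integrableB measurableT imu inu).
rewrite -RintegralB//; apply: (le_trans (le_normr_Rintegral measurableT iB)).
rewrite [leRHS](_ : _ = \int[m]_x (cst (L * tv_dist mu nu) : T -> R) x); last first.
  by rewrite Rintegral_cst//= probability_setT mulr1.
apply: le_Rintegral => //.
- exact: integrable_norm iB.
- exact: finite_measure_integrable_cst.
- by move=> x _; exact: influence_lipschitz.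
Qed.

End smooth.
End influence.

(** * Descent estimates for real functions along one segment *)

(* F t is the value of J at (1 - t) mu + t \d_x, a = J mu, c = J nu for a
   competitor nu, and G = - min h_mu. *)
Section interpolation.
Context (R : realType) (F slope : R -> R) (L G a c : R).
Context (gap_ge0 : 0 <= G).
Context (gap_le : G <= L).
Context (suboptimality : a - c <= G).
Context (start : forall t : R, 0 <= t <= 1 -> F t - a <= t * slope t).
Context (increment : forall s t : R, 0 <= s -> s <= t -> t <= 1 ->
  F t - F s <= (t - s) * slope t).
Context (slope_head : forall t : R, 0 <= t <= 1 -> (1 - t) * slope t <= L * t - G).
Context (slope_tail : forall s t : R, 0 <= s -> s <= t -> t <= 1 ->
  t * slope t <= s * slope s + L * (t - s)).

(** Scaled instances of [slope_head], then of [slope_tail] from [s = 1 / 3], since [slope_head] says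
    nothing about the slope at [t = 1]. At [1 / 2] both bounds are kept: [step_full] combines
    them. *)
Let slope_bounds :
  [/\ 5 * slope (1 / 6) <= L - 6 * G, 2 * slope (1 / 3) <= L - 3 * G,
      slope (1 / 2) <= L - 2 * G &
      [/\ 3 * slope (1 / 2) <= 2 * slope (1 / 3) + L,
          2 * slope (2 / 3) <= slope (1 / 3) + L,
          5 * slope (5 / 6) <= 2 * slope (1 / 3) + 3 * L &
          3 * slope 1 <= slope (1 / 3) + 2 * L]].
Proof.
split; last split.
- by have := @slope_head (1 / 6) ltac:(lra); lra.
- by have := @slope_head (1 / 3) ltac:(lra); lra.
- by have := @slope_head (1 / 2) ltac:(lra); lra.
- by have := @slope_tail (1 / 3) (1 / 2) ltac:(lra) ltac:(lra) ltac:(lra); lra.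
- by have := @slope_tail (1 / 3) (2 / 3) ltac:(lra) ltac:(lra) ltac:(lra); lra.
- by have := @slope_tail (1 / 3) (5 / 6) ltac:(lra) ltac:(lra) ltac:(lra); lra.
- by have := @slope_tail (1 / 3) 1 ltac:(lra) ltac:(lra) ltac:(lra); lra.
Qed.

(** A right-endpoint Riemann sum, whose first cell uses [start] because it begins at [a] instead of
    [F 0]. *)
Let increment_two_thirds : F (2 / 3) - a <=
  (slope (1 / 6) + slope (1 / 3) + slope (1 / 2) + slope (2 / 3)) / 6.
Proof.
have := @start (1 / 6) ltac:(lra).
have := @increment (1 / 6) (1 / 3) ltac:(lra) ltac:(lra) ltac:(lra).
have := @increment (1 / 3) (1 / 2) ltac:(lra) ltac:(lra) ltac:(lra).
have := @increment (1 / 2) (2 / 3) ltac:(lra) ltac:(lra) ltac:(lra).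
lra.
Qed.

Lemma step_full : F 1 - c <= L * (2 / 3).
Proof.
have := @increment (2 / 3) (5 / 6) ltac:(lra) ltac:(lra) ltac:(lra).
have := @increment (5 / 6) 1 ltac:(lra) ltac:(lra) ltac:(lra).
have [? ? ? [? ? ? ?]] := slope_bounds; have := increment_two_thirds.
have := gap_ge0; have := gap_le; have := suboptimality.
lra.
Qed.

Lemma step_two_thirds : a - c <= L * (2 / 3) ->
  F (2 / 3) - c <= L / 2.
Proof.
have [? ? ? [? ? _ _]] := slope_bounds; have := increment_two_thirds.
have := gap_ge0; have := gap_le; have := suboptimality.
lra.
Qed.

(* A rational substitute for - ln (1 - t): q' t >= 1 / (1 - t), while
   (1 - t) q t = t - t^2 / 2 is just small enough for the induction. *)
Let q (t : R) : R := ((1 - t)^-1 - (1 - t)) / 2.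

(** This has the shape required by [le_of_quadratic_defect]; [t <= 1 / 2] gives [2 * (1 - t) >= 1],
    hence the constant 1. *)
Let increment_q (s t : R) : 0 <= s -> s <= t -> t <= 1 / 2 ->
  (t - s) / (1 - t) - (q t - q s) <= (t - s) ^+ 2.
Proof.
move=> s0 st t2.
have t0 : 0 < 1 - t by lra.
have s1 : 0 < 1 - s by lra.
have -> : (t - s) / (1 - t) - (q t - q s) =
    (t - s) ^+ 2 / (2 * (1 - t)) - (t - s) * s ^+ 2 / (2 * (1 - t) * (1 - s)).
  by rewrite /q; field; rewrite !gt_eqF.
have ts : 0 <= t - s by lra.
rewrite lerBlDr -[leLHS]addr0 lerD//.
  by rewrite ler_pdivrMr ?mulr_gt0// ler_peMr ?sqr_ge0//; lra.
by rewrite divr_ge0 ?mulr_ge0 ?sqr_ge0// ltW.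
Qed.

(** [slope_head] integrates to [F eta <= a - L * eta + (L - G) * q eta]. Replacing [G] by [a - c],
    then [a - c] by [L * eta], leaves [L * (1 - eta) * q eta], which is the stated bound. *)
Lemma step_small (eta : R) : 0 <= eta -> eta <= 1 / 2 ->
  a - c <= L * eta ->
  F eta - c <= L * (eta - eta ^+ 2 / 2).
Proof.
move=> e0 e2 Jeta.
have e01 : 0 <= eta <= 1 by lra.
have decr : F eta + L * eta - (L - G) * q eta <=
            F 0 + L * 0 - (L - G) * q 0.
  apply: (le_of_quadratic_defect (f := fun t =>
    F t + L * t - (L - G) * q t) (C := L - G)) => // s t s0 st te.
  have t1 : 0 < 1 - t by lra.
  have t01 : 0 <= t <= 1 by lra.
  have t2 : t <= 1 / 2 by lra.
  have LG : 0 <= L - G by rewrite subr_ge0.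
  have ts0 : 0 <= t - s by lra.
  have slope_le : slope t <= (L - G) / (1 - t) - L.
    have := slope_head t01; rewrite -ler_pdivlMl// => /le_trans; apply.
    by rewrite le_eqVlt; apply/orP; left; apply/eqP; field; rewrite gt_eqF.
  have inc := increment s0 st (ltac:(lra) : t <= 1).
  have := ler_wpM2l ts0 slope_le.
  have := ler_wpM2l LG (increment_q s0 st t2).
  by move: inc; lra.
have q0 : q 0 = 0 by rewrite /q subr0 invr1 subrr mul0r.
(* At [t = 0], [start] yields [F 0 <= a], the direction required. *)
have := @start 0; rewrite lexx ler01 mul0r => /(_ isT) F0.
have qe : q eta * (1 - eta) = eta - eta ^+ 2 / 2.
  by rewrite /q; field; lra.
have e1 : 0 < 1 - eta by lra.
(* These signs justify the two replacements: [G] enters with coefficient [- q eta], and [a - c] then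
   with [1 - q eta]. *)
have q_itv : 0 <= q eta <= 1.
  by rewrite -(pmulr_lge0 _ e1) -[_ <= 1](ler_pM2r e1) qe; nra.
have [q_ge0 q_le1] := andP q_itv.
have gq := ler_wpM2r q_ge0 suboptimality.
have eq := ler_wpM2r (_ : 0 <= 1 - q eta) Jeta; rewrite subr_ge0 in eq.
have {}eq := eq q_le1.
by rewrite -qe; move: decr gq eq; rewrite q0; lra.
Qed.

(** Three regimes: [eta = 1] for [k = 0], where no earlier bound is available, [eta = 2 / 3] for
    [k = 1], and [eta <= 1 / 2] afterwards. *)
Lemma frank_wolfe_descent (k : nat) :
  ((1 <= k)%N -> a - c <= 2 * L / (k%:R + 2)) ->
  F (2 / (k%:R + 2)) - c <= 2 * L / (k.+1%:R + 2).
Proof.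
have L0 : 0 <= L by exact: le_trans gap_le.
case: k => [|[|k]] gap_k.
- rewrite add0r divff// (_ : 2 * L / (1 + 2) = L * (2 / 3)); last by field.
  exact: step_full.
- rewrite (_ : 1 + 2 = 3 :> R); last by ring.
  rewrite (_ : 2 * L / (2 + 2) = L / 2); last by field.
  apply: step_two_thirds; have := gap_k isT.
  by rewrite (_ : 2 * L / (1 + 2) = L * (2 / 3)); last by field.
have k0 : 0 <= k%:R :> R by [].
have k2E : k.+2%:R = k%:R + 2 :> R by rewrite -addn2 natrD.
rewrite k2E.
have -> : k.+3%:R = k%:R + 3 :> R by rewrite -addn3 natrD.
apply: le_trans (step_small _ _ _) _.
- by rewrite divr_ge0//; lra.
- by rewrite ler_pdivrMr; lra.
- apply: le_trans (gap_k isT) _.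
  by rewrite k2E mulrA (mulrC L).
rewrite (mulrC 2 L) -(mulrA L) ler_wpM2l//.
rewrite -subr_ge0.
(* With [m = k + 4] and [eta = 2 / m], [eta - eta ^+ 2 / 2] is [2 * (m - 1) / m ^+ 2]; the claim
   amounts to [(m - 1) * (m + 1) <= m ^+ 2]. *)
have -> : 2 / (k%:R + 3 + 2) -
    (2 / (k%:R + 2 + 2) - (2 / (k%:R + 2 + 2)) ^+ 2 / 2) =
    2 / ((k%:R + 3 + 2) * (k%:R + 2 + 2) ^+ 2) :> R.
  by field; rewrite !gt_eqF; lra.
by rewrite divr_ge0// mulr_ge0 ?sqr_ge0//; lra.
Qed.

End interpolation.

(** * One Frank-Wolfe step *)

Section frank_wolfe_step.
Context d (T : measurableType d) (R : realType).
Context (J : probability T R -> R) (L : R).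
Context (dJ : forall m, von_mises_exists J m).
Context (cJ : convex_functional J).
Context (sJ : smooth_functional L J).
Context (L0 : 0 <= L).
Context (mu nu : probability T R) (x : T).
Context (argmin_x : argmin (influence J mu) x).

Let path (t : R) : probability T R := mix t mu \d_x.

Let G := - influence J mu x.

Let slope (t : R) : R :=
  influence J (path t) x - \int[mu]_y influence J (path t) y.

Let mean_influence_path (s t : R) : 0 <= s <= 1 ->
  \int[path s]_y influence J (path t) y =
  (1 - s) * \int[mu]_y influence J (path t) y + s * influence J (path t) x.
Proof.
move=> s01; rewrite Rintegral_mix//; last exact: influence_integrable.
by rewrite -(von_misesE (dJ (path t)) \d_x).
Qed.

Let mean_influence0 (t : R) : 0 <= t <= 1 ->
  (1 - t) * \int[mu]_y influence J (path t) y + t * influence J (path t) x = 0.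
Proof. by move=> t01; rewrite -mean_influence_path// Rintegral_influence. Qed.

(** The subgradient inequality at [path t] is tested on [path s]; subtracting the normalization at
    [path t] turns its left side into [(s - t) * slope t]. *)
Let path_increment (s t : R) : 0 <= s -> s <= t -> t <= 1 ->
  J (path t) - J (path s) <= (t - s) * slope t.
Proof.
move=> s0 st t1.
have s01 : 0 <= s <= 1 by lra.
have t01 : 0 <= t <= 1 by lra.
have := convex_subgradient (dJ (path t)) (path s) cJ.
rewrite mean_influence_path//; have := mean_influence0 t01.
by rewrite /slope; lra.
Qed.

Let path_start (t : R) : 0 <= t <= 1 -> J (path t) - J mu <= t * slope t.
Proof.
move=> t01; have := convex_subgradient (dJ (path t)) mu cJ.
by have := mean_influence0 t01; rewrite /slope; lra.
Qed.

Let slope_head (t : R) : 0 <= t <= 1 -> (1 - t) * slope t <= L * t - G.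
Proof.
move=> t01; have := mean_influence0 t01.
have := influence_lipschitz sJ (path t) mu x.
have := ler_wpM2l L0 (tv_dist_mixl mu \d_x t01).
rewrite ler_norml -/(path t) /slope /G; lra.
Qed.

Let slope_tail (s t : R) : 0 <= s -> s <= t -> t <= 1 ->
  t * slope t <= s * slope s + L * (t - s).
Proof.
move=> s0 st t1.
have s01 : 0 <= s <= 1 by lra.
have t01 : 0 <= t <= 1 by lra.
have := mean_influence0 s01; have := mean_influence0 t01.
have := Rintegral_influence_lipschitz dJ sJ (path t) (path s) mu.
have := ler_wpM2l L0 (tv_dist_mix mu \d_x t01 s01).
by rewrite (ger0_norm (_ : 0 <= t - s)) ?subr_ge0// ler_norml /slope; lra.
Qed.

Let gap_ge0 : 0 <= G.
Proof.
by rewrite /G oppr_ge0 -(Rintegral_influence (dJ mu)) le_Rintegral_influence.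
Qed.

Let gap_le : G <= L.
Proof.
have := norm_influence dJ sJ mu x.
have := ler_wpM2l L0 (tv_dist_le1 mu \d_x).
by rewrite ler_norml /G; lra.
Qed.

Let suboptimality_le_gap : J mu - J nu <= G.
Proof.
have := convex_subgradient (dJ mu) nu cJ.
have := le_Rintegral_influence (dJ mu) nu argmin_x.
by rewrite /G; lra.
Qed.


Lemma frank_wolfe_step (k : nat) :
  ((1 <= k)%N -> J mu - J nu <= 2 * L / (k%:R + 2)) ->
  J (mix (2 / (k%:R + 2)) mu \d_x) - J nu <= 2 * L / (k.+1%:R + 2).
Proof.
exact: (frank_wolfe_descent (F := J \o path) gap_ge0 gap_le suboptimality_le_gap
  path_start path_increment slope_head slope_tail).
Qed.

End frank_wolfe_step.

(** * Induction over the iterations *)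

Lemma frank_wolfe_rate d (T : measurableType d) (R : realType)
    (J : probability T R -> R) (L : R) (x : nat -> T)
    (mu : nat -> probability T R) :
  (forall m, von_mises_exists J m) -> convex_functional J ->
  smooth_functional L J -> frank_wolfe J (fun k => 2 / (k%:R + 2)) x mu ->
  forall (nu : probability T R) (k : nat), (1 <= k)%N ->
  J (mu k) - J nu <= 2 * L * tv_diameter T R ^+ 2 / (k%:R + 2).
Proof.
move=> dJ cJ sJ FW nu k k1.
have [diam0|[y [z [yz1 ->]]]] := tv_diameter_eq01 T R.
  rewrite diam0 expr0n/= mulr0 mul0r.
  have [xk _] := FW k.
  have tv0 : tv_dist (mu k) \d_(x k) = 0.
    by apply/eqP; rewrite eq_le tv_dist_ge0 andbT -diam0 tv_dist_le_diameter.
  have := norm_influence dJ sJ (mu k) (x k); rewrite tv0 mulr0 normr_le0 => /eqP h0.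
  have := convex_subgradient (dJ (mu k)) nu cJ.
  have := le_Rintegral_influence (dJ (mu k)) nu xk; rewrite h0.
  lra.
have L0 : 0 <= L.
  have := influence_lipschitz sJ \d_y \d_z y.
  by rewrite yz1 mulr1; exact: le_trans.
(* [IH] is conditional on [1 <= k], so it is void for the first step, in agreement with the premise
   of [frank_wolfe_step]. *)
rewrite expr1n mulr1; elim: k k1 => // k IH _.
have [xk ->] := FW k.
exact: frank_wolfe_step.
Qed.


Theorem theorem1 (R : realType) (d : nat) (X : set 'rV[R]_d)
    (X0 : X !=set0) (cX : compact X)
    (J : probability (borel_space X0) R -> R) (L : R)
    (Jderiv : forall mu, von_mises_exists J mu)
    (Jconvex : convex_functional J)
    (Jsmooth : smooth_functional L J)
    (x : nat -> borel_space X0) (mu : nat -> probability (borel_space X0) R)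
    (FW : frank_wolfe J (fun k => 2 / (k%:R + 2)) x mu) :
  (forall k : nat, (1 <= k)%N ->
    ((J (mu k))%:E - inf_value J <=
     (2 * L * tv_diameter (borel_space X0) R ^+ 2 / (k%:R + 2))%:E)%E) /\
  tv_diameter (borel_space X0) R <= 2.
Proof.
split; last by apply: le_trans (tv_diameter_le1 _ _) _; rewrite ler1n.
(* Isolating [inf_value J], a priori possibly infinite, reduces the claim to the bound against each
   competitor [nu]. *)
move=> k k1; rewrite lee_subel_addr// addeC -leeBlDr//.
apply/ereal_infP => _ [nu _ <-]; rewrite -EFinB lee_fin.
have := frank_wolfe_rate Jderiv Jconvex Jsmooth FW nu k1.
lra.
Qed.
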